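(* Let $x$ be a set and let $\langle P(x)\rangle$ be the $\mathbb{K}$-vector space with basis the set $P(x)$ of all subsets of $x$. Define linear maps by $\cup(a\otimes b)=a\cup b$, $\cap(a\otimes b)=a\cap b$, $c(a)=x\setminus a$, $\triangle(a)=a\otimes a$, $ev(a)=1$ for $a,b\subseteq x$ (extended linearly), and $E(s)=s\,\emptyset$, $T(s)=s\,x$ for $s\in\mathbb{K}$. Then $(\langle P(x)\rangle,\cup,\cap,c,T,E,\triangle,ev)$ is a Boolean algebra.
   Context: $\mathbb{K}$ is a field of characteristic zero. For a vector space $V$, $S:V\otimes V\to V\otimes V$ is $S(u\otimes v)=v\otimes u$ and $I$ is the identity. A Boolean algebra is a $\mathbb{K}$-vector space $V$ with linear maps $\cup,\cap:V\otimes V\to V$ (union, intersection), $c:V\to V$ (complement), $T,E:\mathbb{K}\to V$ (total, empty), $\triangle:V\to V\otimes V$ (coproduct), $ev:V\to\mathbb{K}$ (evaluation), satisfying (identifying $V\otimes\mathbb{K}\cong V\cong\mathbb{K}\otimes V$): (1) $\cup=\cup\circ S$, $\cap=\cap\circ S$; (2) $\cup\circ(\cup\otimes I)=\cup\circ(I\otimes\cup)$, $\cap\circ(\cap\otimes I)=\cap\circ(I\otimes\cap)$; (3) $\cap\circ(I\otimes\cup)=\cup\circ(\cap\otimes\cap)\circ(I\otimes S\otimes I)\circ(\triangle\otimes I\otimes I)$ and $\cup\circ(I\otimes\cap)=\cap\circ(\cup\otimes\cup)\circ(I\otimes S\otimes I)\circ(\triangle\otimes I\otimes I)$; (4) $\cup\circ(I\otimes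 E)=I$, $\cap\circ(I\otimes T)=I$; (5) $\cap\circ(I\otimes c)\circ\triangle=E\circ ev$, $\cup\circ(I\otimes c)\circ\triangle=T\circ ev$; (6) $\cap\circ(I\otimes\cup)\circ(\triangle\otimes I)=I\otimes ev$, $\cup\circ(I\otimes\cap)\circ(\triangle\otimes I)=I\otimes ev$; (7) $(\triangle\otimes I)\circ\triangle=(I\otimes\triangle)\circ\triangle$; (8) $S\circ\triangle=\triangle$. *)

(* Defs.v *)
From HB Require Import structures.
From mathcomp Require Import all_boot all_algebra.
From mathcomp Require Import generic_quotient ring_quotient sesquilinear.
From mathcomp Require Import boolp classical_sets.
From mathcomp Require Import freeg.

Set Implicit Arguments.
Unset Strict Implicit.
Unset Printing Implicit Defensive.

Import GRing.Theory.
Local Open Scope ring_scope.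
Local Open Scope quotient_scope.

Section FreeModule.
Context (K : fieldType) (C : choiceType).
Implicit Types (W : lmodType K) (p q : {freeg C / K}).

Lemma fgliftE W (f : C -> W) p :
  fglift f p = \sum_(a <- dom p) coeff a p *: f a.
Proof.
rewrite -{1}[p]Freeg_dom fglift_Freeg /prelift big_map.
by apply: eq_bigr.
Qed.

Lemma scale_freegU (a b : K) (x : C) : a *: << b *g x >> = << (a * b) *g x >>.
Proof. by apply/eqP/freeg_eqP => y; rewrite coeffZ !coeffU mulrA. Qed.

Lemma fglift_is_linear W (f : C -> W) : linear (fglift f).
Proof.
move=> a p q.
have fD : {morph fglift f : x y / x + y >-> x + y}.
  have fB := lift_is_additive f => x y.
  have f0 : fglift f 0 = 0 by rewrite -(subrr 0) fB subrr.
  have fN z : fglift f (- z) = - fglift f z by rewrite -sub0r fB f0 sub0r.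
  by rewrite -{1}[y]opprK fB fN opprK.
have f0 : fglift f 0 = 0 by apply: (addIr (fglift f 0)); rewrite -fD !add0r.
rewrite fD; congr (_ + _).
rewrite -[p in LHS]freeg_sumE scaler_sumr (big_morph _ fD f0) fgliftE scaler_sumr.
by apply: eq_bigr => x _; rewrite scale_freegU liftU scalerA.
Qed.
HB.instance Definition _ W (f : C -> W) :=
  GRing.isLinear.Build K {freeg C / K} W *:%R (fglift f) (fglift_is_linear f).

Lemma freegUE (b : K) (x : C) : << b *g x >> = b *: << x >>.
Proof. by rewrite scale_freegU mulr1. Qed.

Lemma eq_linear_freeg W (f g : {linear {freeg C / K} -> W}) :
  (forall x, f << x >> = g << x >>) -> f =1 g.
Proof.
move=> fg p; rewrite -[p]freeg_sumE !linear_sum.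
by apply: eq_bigr => x _; rewrite freegUE !linearZ fg.
Qed.

End FreeModule.

Section FreeBilinear.
Context (K : fieldType) (C D : choiceType) (W : lmodType K).

Definition fglift2 (h : C -> D -> W) (p : {freeg C / K}) (q : {freeg D / K}) :
  W := fglift (fun a => fglift (h a) q) p.

Lemma fglift2_is_bilinear (h : C -> D -> W) :
  bilinear_for *:%R *:%R (fglift2 h).
Proof.
split=> [q|p] a x y /=; rewrite /fglift2 ?linearP //.
rewrite !fgliftE scaler_sumr -big_split /=; apply: eq_bigr => c _.
by rewrite linearP scalerDr !scalerA mulrC.
Qed.
HB.instance Definition _ (h : C -> D -> W) :=
  bilinear_isBilinear.Build K _ _ W *:%R *:%R (fglift2 h)
    (fglift2_is_bilinear h).

Lemma fglift2U (h : C -> D -> W) a b : fglift2 h << a >> << b >> = h a b.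
Proof. by rewrite /fglift2 !liftU !scale1r. Qed.

End FreeBilinear.

(* U ⊗ V is the free space on U * V modulo the span of the bilinearity
   relations. *)
Section Tensor.
Context (K : fieldType) (U V : lmodType K).
Local Notation F := {freeg (U * V)%type / K}.

Inductive tens_rel : F -> Prop :=
| tens_rel_l a u u' v :
    tens_rel (<< (a *: u + u', v) >> - (a *: << (u, v) >> + << (u', v) >>))
| tens_rel_r a u v v' :
    tens_rel (<< (u, a *: v + v') >> - (a *: << (u, v) >> + << (u, v') >>)).

Inductive tens_span : F -> Prop :=
| tens_span0 : tens_span 0
| tens_spanP a p q : tens_rel p -> tens_span q -> tens_span (a *: p + q).

Definition tens_ker : {pred F} := fun p => `[< tens_span p >].

Lemma tens_kerP p : reflect (tens_span p) (p \in tens_ker).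
Proof. exact: asboolP. Qed.

Lemma tens_span_lin a p q :
  tens_span p -> tens_span q -> tens_span (a *: p + q).
Proof.
move=> sp sq; elim: sp => [|b r s Rr _ IH]; first by rewrite scaler0 add0r.
by rewrite scalerDr scalerA -addrA; apply: tens_spanP.
Qed.

Lemma tens_ker_closed : zmod_closed tens_ker.
Proof.
split=> [|p q /tens_kerP sp /tens_kerP sq]; apply/tens_kerP.
  exact: tens_span0.
by rewrite addrC -scaleN1r; apply: tens_span_lin.
Qed.
HB.instance Definition _ := GRing.isZmodClosed.Build F tens_ker tens_ker_closed.

Definition tensor : Type := Quotient.quot (tens_ker : zmodClosed F).
HB.instance Definition _ := GRing.Zmodule.on tensor.
HB.instance Definition _ :=
  ZmodQuotient.copy tensor (Quotient.quot (tens_ker : zmodClosed F)).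

Lemma tensor_eqP p q :
  reflect (tens_span (p - q)) (\pi_tensor p == \pi_tensor q).
Proof. by rewrite -Quotient.idealrBE; apply: tens_kerP. Qed.

Lemma pi_tensorD p q : \pi_tensor (p + q) = \pi_tensor p + \pi_tensor q.
Proof. exact: raddfD. Qed.

Definition tensor_scale (a : K) (t : tensor) : tensor := \pi_tensor (a *: repr t).

Lemma pi_scale a p : \pi_tensor (a *: p) = tensor_scale a (\pi_tensor p).
Proof.
apply/eqP/tensor_eqP; rewrite -scalerBr -[_ *: _]addr0.
apply: tens_span_lin tens_span0; apply/tensor_eqP.
by rewrite reprK.
Qed.

Lemma tensor_scaleA a b t :
  tensor_scale a (tensor_scale b t) = tensor_scale (a * b) t.
Proof. by elim/quotW: t => p; rewrite -(pi_scale b p) -!pi_scale scalerA. Qed.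
Lemma tensor_scale1 : left_id 1 tensor_scale.
Proof. by elim/quotW=> p; rewrite -pi_scale scale1r. Qed.
Lemma tensor_scaleDr : right_distributive tensor_scale +%R.
Proof.
move=> a; elim/quotW=> p; elim/quotW=> q.
by rewrite -pi_tensorD -(pi_scale a p) -(pi_scale a q) -pi_scale scalerDr pi_tensorD.
Qed.
Lemma tensor_scaleDl t : {morph tensor_scale^~ t : a b / a + b}.
Proof. by elim/quotW: t => p a b; rewrite -!pi_scale scalerDl pi_tensorD. Qed.
HB.instance Definition _ := GRing.Zmodule_isLmodule.Build K tensor
  tensor_scaleA tensor_scale1 tensor_scaleDr tensor_scaleDl.

Lemma pi_tensorP a p q :
  \pi_tensor (a *: p + q) = a *: \pi_tensor p + \pi_tensor q.
Proof. by rewrite pi_tensorD pi_scale. Qed.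

Definition tens (u : U) (v : V) : tensor := \pi_tensor << (u, v) >>.

Lemma tens_is_bilinear : bilinear_for *:%R *:%R tens.
Proof.
split=> [v|u] a x y; rewrite /tens.
- rewrite -pi_tensorP.
  apply/eqP/tensor_eqP; rewrite -[X in tens_span X]scale1r -[_ *: _]addr0.
  exact/tens_spanP/tens_span0/tens_rel_l.
- rewrite -pi_tensorP.
  apply/eqP/tensor_eqP; rewrite -[X in tens_span X]scale1r -[_ *: _]addr0.
  exact/tens_spanP/tens_span0/tens_rel_r.
Qed.
HB.instance Definition _ := bilinear_isBilinear.Build K U V tensor *:%R *:%R
  tens tens_is_bilinear.
HB.instance Definition _ u := GRing.isLinear.Build K V tensor *:%R
  (tens u) (tens_is_bilinear.2 u).

Section Lift.
Context (W : lmodType K) (f : {bilinear U -> V -> W}).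

Definition tens_lift (t : tensor) : W :=
  fglift (fun uv : U * V => f uv.1 uv.2) (repr t).

Lemma tens_lift_pi p :
  tens_lift (\pi_tensor p) = fglift (fun uv : U * V => f uv.1 uv.2) p.
Proof.
pose g : {linear F -> W} := fglift (fun uv : U * V => f uv.1 uv.2).
have gU u v : g << (u, v) >> = f u v by rewrite /g /= liftU scale1r.
have : \pi_tensor (repr (\pi_tensor p)) == \pi_tensor p by rewrite reprK.
move=> /tensor_eqP kp; apply/eqP; rewrite -subr_eq0; apply/eqP.
transitivity (g (repr (\pi_tensor p) - p)); first by rewrite linearB.
elim: kp => [|a r q Rr _ IH]; first exact: linear0.
rewrite linearP IH addr0; case: Rr => [b u u' v|b u v v'];
  by rewrite linearB linearP !gU ?linearPl ?linearPr subrr scaler0.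
Qed.

Lemma tens_lift_is_linear : linear tens_lift.
Proof.
move=> a; elim/quotW=> p; elim/quotW=> q.
rewrite -pi_tensorP !tens_lift_pi.
exact: linearP.
Qed.
HB.instance Definition _ := GRing.isLinear.Build K tensor W *:%R
  tens_lift tens_lift_is_linear.

Lemma tens_liftE u v : tens_lift (tens u v) = f u v.
Proof. by rewrite tens_lift_pi liftU scale1r. Qed.

End Lift.

Lemma eq_linear_tens (W : lmodType K) (f g : {linear tensor -> W}) :
  (forall u v, f (tens u v) = g (tens u v)) -> f =1 g.
Proof.
move=> fg; elim/quotW=> p.
have pi0 : \pi_tensor (0 : F) = 0.
  by apply: (addIr (\pi_tensor 0)); rewrite -pi_tensorD !add0r.
rewrite -[p]freeg_sumE (big_morph _ pi_tensorD pi0) !linear_sum.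
apply: eq_bigr => -[u v] _; rewrite freegUE pi_scale.
by rewrite -[tensor_scale _ _]/(_ *: tens u v) !linearZ fg.
Qed.

End Tensor.

Notation "U ⊗ V" := (tensor U V) (at level 40, left associativity) : type_scope.

Section TensorMap.
Context (K : fieldType) (U V U' V' : lmodType K).
Context (f : {linear U -> U'}) (g : {linear V -> V'}).

Definition tmap_fun (u : U) (v : V) : U' ⊗ V' := tens (f u) (g v).

Lemma tmap_fun_is_bilinear : bilinear_for *:%R *:%R tmap_fun.
Proof.
by split=> [v|u] a x y; rewrite /tmap_fun linearP ?linearPl ?linearPr.
Qed.
HB.instance Definition _ := bilinear_isBilinear.Build K U V (U' ⊗ V')
  *:%R *:%R tmap_fun tmap_fun_is_bilinear.

Definition tmap : {linear U ⊗ V -> U' ⊗ V'} := tens_lift tmap_fun.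

Lemma tmapE u v : tmap (tens u v) = tens (f u) (g v).
Proof. exact: tens_liftE. Qed.

End TensorMap.

Section Swap.
Context (K : fieldType) (U V : lmodType K).

Definition tswap_fun (u : U) (v : V) : V ⊗ U := tens v u.

Lemma tswap_fun_is_bilinear : bilinear_for *:%R *:%R tswap_fun.
Proof. by split=> [v|u] a x y; rewrite /tswap_fun ?linearPl ?linearPr. Qed.
HB.instance Definition _ := bilinear_isBilinear.Build K U V (V ⊗ U)
  *:%R *:%R tswap_fun tswap_fun_is_bilinear.

Definition tswap : {linear U ⊗ V -> V ⊗ U} := tens_lift tswap_fun.

Lemma tswapE u v : tswap (tens u v) = tens v u.
Proof. exact: tens_liftE. Qed.

End Swap.

Section Unitor.
Context (K : fieldType) (V : lmodType K).

Definition tunitr_fun (v : V) (s : K^o) : V := (s : K) *: v.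

Lemma tunitr_fun_is_bilinear : bilinear_for *:%R *:%R tunitr_fun.
Proof.
split=> [s|v] a x y; rewrite /tunitr_fun.
  by rewrite scalerDr; congr (_ + _); rewrite scalerA mulrC -scalerA.
by rewrite -[a *: x + y]/(a * (x : K) + (y : K)) scalerDl -scalerA.
Qed.
HB.instance Definition _ := bilinear_isBilinear.Build K V K^o V
  *:%R *:%R tunitr_fun tunitr_fun_is_bilinear.

Definition tunitr : {linear V ⊗ K^o -> V} := tens_lift tunitr_fun.

Lemma tunitrE v (s : K^o) : tunitr (tens v s) = (s : K) *: v.
Proof. exact: tens_liftE. Qed.

End Unitor.

Section Assoc.
Context (K : fieldType) (U V W : lmodType K).

Definition tassoc_fun (t : U ⊗ V) (w : W) : U ⊗ (V ⊗ W) :=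
  tmap idfun (applyr (@tens K V W) w) t.

Lemma tassoc_fun_is_bilinear : bilinear_for *:%R *:%R tassoc_fun.
Proof.
split=> [w|t] a x y; rewrite /tassoc_fun; first exact: linearP.
suff : tassoc_fun^~ (a *: x + y) =1 (a \*: tmap idfun (applyr (@tens K V W) x)
          \+ tmap idfun (applyr (@tens K V W) y)) by apply.
apply: eq_linear_tens => u v /=.
by rewrite !tmapE /= linearPr linearPr.
Qed.
HB.instance Definition _ := bilinear_isBilinear.Build K (U ⊗ V) W (U ⊗ (V ⊗ W))
  *:%R *:%R tassoc_fun tassoc_fun_is_bilinear.

Definition tassoc : {linear (U ⊗ V) ⊗ W -> U ⊗ (V ⊗ W)} := tens_lift tassoc_fun.

Lemma tassocE u v w : tassoc (tens (tens u v) w) = tens u (tens v w).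
Proof.
transitivity (tassoc_fun (tens u v) w); first exact: tens_liftE.
exact: tmapE.
Qed.

End Assoc.

Section AssocInv.
Context (K : fieldType) (U V W : lmodType K).

Definition tassocV_fun (u : U) (t : V ⊗ W) : (U ⊗ V) ⊗ W :=
  tmap (@tens K U V u) idfun t.

Lemma tassocV_fun_is_bilinear : bilinear_for *:%R *:%R tassocV_fun.
Proof.
split=> [t|u] a x y; rewrite /tassocV_fun; last exact: linearP.
suff : tassocV_fun (a *: x + y) =1
    (a \*: tmap (@tens K U V x) idfun \+ tmap (@tens K U V y) idfun) by apply.
apply: eq_linear_tens => v w /=.
by rewrite !tmapE /= linearPl linearPl.
Qed.
HB.instance Definition _ := bilinear_isBilinear.Build K U (V ⊗ W) ((U ⊗ V) ⊗ W)
  *:%R *:%R tassocV_fun tassocV_fun_is_bilinear.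

Definition tassocV : {linear U ⊗ (V ⊗ W) -> (U ⊗ V) ⊗ W} :=
  tens_lift tassocV_fun.

Lemma tassocVE u v w : tassocV (tens u (tens v w)) = tens (tens u v) w.
Proof.
transitivity (tassocV_fun u (tens v w)); first exact: tens_liftE.
exact: tmapE.
Qed.

End AssocInv.

(* The map S ⊗ I on V ⊗ V ⊗ V, bracketed as V ⊗ (V ⊗ V). *)
Definition tswapl (K : fieldType) (V : lmodType K) :
    {linear V ⊗ (V ⊗ V) -> V ⊗ (V ⊗ V)} :=
  tassoc V V V \o tmap (tswap V V) idfun \o tassocV V V V.

Lemma tswaplE (K : fieldType) (V : lmodType K) (a b c : V) :
  tswapl V (tens a (tens b c)) = tens b (tens a c).
Proof.
by rewrite -[LHS]/(tassoc _ _ _ (tmap _ _ (tassocV _ _ _ _)))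
           tassocVE tmapE tswapE tassocE.
Qed.

(* The map I ⊗ S ⊗ I on V ⊗ V ⊗ V ⊗ V, bracketed as (V ⊗ V) ⊗ (V ⊗ V). *)
Definition tmidswap (K : fieldType) (V : lmodType K) :
    {linear (V ⊗ V) ⊗ (V ⊗ V) -> (V ⊗ V) ⊗ (V ⊗ V)} :=
  tassocV V V (V ⊗ V) \o tmap idfun (tswapl V) \o tassoc V V (V ⊗ V).

Lemma tmidswapE (K : fieldType) (V : lmodType K) (a b c d : V) :
  tmidswap V (tens (tens a b) (tens c d)) = tens (tens a c) (tens b d).
Proof.
by rewrite -[LHS]/(tassocV _ _ _ (tmap _ _ (tassoc _ _ _ _)))
           tassocE tmapE tswaplE tassocVE.
Qed.

(* Triple tensor powers are bracketed; tassoc and tunitr make the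
   identifications (V ⊗ V) ⊗ V = V ⊗ (V ⊗ V) and V ⊗ K = V explicit. *)
Record is_boolean_algebra (K : fieldType) (V : lmodType K)
    (cup cap : {linear V ⊗ V -> V}) (c : {linear V -> V})
    (T E : {linear K^o -> V}) (D : {linear V -> V ⊗ V})
    (ev : {linear V -> K^o}) : Prop := IsBooleanAlgebra {
  ba_cupC : cup =1 cup \o tswap V V;
  ba_capC : cap =1 cap \o tswap V V;
  ba_cupA : cup \o tmap cup idfun =1 cup \o tmap idfun cup \o tassoc V V V;
  ba_capA : cap \o tmap cap idfun =1 cap \o tmap idfun cap \o tassoc V V V;
  ba_capUr : cap \o tmap idfun cup =1
    cup \o tmap cap cap \o tmidswap V \o tmap D (tmap idfun idfun);
  ba_cupIr : cup \o tmap idfun cap =1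
    cap \o tmap cup cup \o tmidswap V \o tmap D (tmap idfun idfun);
  ba_cupE : cup \o tmap idfun E =1 tunitr V;
  ba_capT : cap \o tmap idfun T =1 tunitr V;
  ba_capc : cap \o tmap idfun c \o D =1 E \o ev;
  ba_cupc : cup \o tmap idfun c \o D =1 T \o ev;
  ba_capK : cap \o tmap idfun cup \o tassoc V V V \o tmap D idfun =1
    tunitr V \o tmap idfun ev;
  ba_cupK : cup \o tmap idfun cap \o tassoc V V V \o tmap D idfun =1
    tunitr V \o tmap idfun ev;
  ba_coassoc : tassoc V V V \o tmap D idfun \o D =1 tmap idfun D \o D;
  ba_cocomm : tswap V V \o D =1 D
}.

Section ScaleLinear.
Context (K : fieldType) (V : lmodType K).

Definition scalev (v : V) (s : K^o) : V := (s : K) *: v.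

Lemma scalev_is_linear v : linear (scalev v).
Proof.
move=> a s t; rewrite /scalev.
by rewrite -[a *: s + t]/(a * (s : K) + (t : K)) scalerDl -scalerA.
Qed.
HB.instance Definition _ v :=
  GRing.isLinear.Build K K^o V *:%R (scalev v) (scalev_is_linear v).

End ScaleLinear.

Section Powerset.
Context (K : fieldType) (X : Type).
Local Open Scope classical_set_scope.

(* The ambient set is the type X, so that its subsets are the terms of set X. *)
Definition powV : lmodType K := {freeg (set X) / K}.

Definition pbase (a : set X) : powV := << a >>.

Definition pow_cup : {linear powV ⊗ powV -> powV} :=
  tens_lift (fglift2 (fun a b : set X => pbase (a `|` b))).
Definition pow_cap : {linear powV ⊗ powV -> powV} :=
  tens_lift (fglift2 (fun a b : set X => pbase (a `&` b))).
Definition pow_compl : {linear powV -> powV} :=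
  fglift (fun a : set X => pbase (~` a)).
Definition pow_total : {linear K^o -> powV} := scalev (pbase setT).
Definition pow_empty : {linear K^o -> powV} := scalev (pbase set0).
Definition pow_coprod : {linear powV -> powV ⊗ powV} :=
  fglift (fun a : set X => tens (pbase a) (pbase a)).
Definition pow_ev : {linear powV -> K^o} := fglift (fun _ : set X => 1 : K^o).

Lemma pow_cupE a b : pow_cup (tens (pbase a) (pbase b)) = pbase (a `|` b).
Proof. exact: etrans (tens_liftE _ _ _) (fglift2U _ _ _). Qed.
Lemma pow_capE a b : pow_cap (tens (pbase a) (pbase b)) = pbase (a `&` b).
Proof. exact: etrans (tens_liftE _ _ _) (fglift2U _ _ _). Qed.
Lemma pow_complE a : pow_compl (pbase a) = pbase (~` a).
Proof. exact: etrans (liftU _ _ _) (scale1r _). Qed.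
Lemma pow_totalE (s : K) : pow_total s = s *: pbase setT. Proof. by []. Qed.
Lemma pow_emptyE (s : K) : pow_empty s = s *: pbase set0. Proof. by []. Qed.
Lemma pow_coprodE a : pow_coprod (pbase a) = tens (pbase a) (pbase a).
Proof. exact: etrans (liftU _ _ _) (scale1r _). Qed.
Lemma pow_evE a : pow_ev (pbase a) = 1.
Proof. exact: etrans (liftU _ _ _) (scale1r _). Qed.

Lemma eq_linear_pow (W : lmodType K) (f g : {linear powV -> W}) :
  (forall a, f (pbase a) = g (pbase a)) -> f =1 g.
Proof. exact: eq_linear_freeg. Qed.

End Powerset.

(* Main.v *)
Require Import Defs.
From mathcomp Require Import all_boot all_algebra.
From mathcomp Require Import boolp classical_sets.

(** Every axiom equates two linear maps out of a tensor power of the space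
    spanned by the subsets, so it can be checked on pure tensors of basis
    elements.  The coproduct duplicates a basis element, which turns each axiom
    there into an identity between sets. *)

Set Implicit Arguments.
Unset Strict Implicit.
Unset Printing Implicit Defensive.

Import GRing.Theory.

Local Open Scope ring_scope.

Section Determining.
Context (K : fieldType).
Implicit Types (U V W : lmodType K) (I J : Type).

(** Spanning, phrased by its effect on linear maps, so that tensor products need no manipulation of
    sums. *)
Definition determining V I (b : I -> V) :=
  forall W (f g : {linear V -> W}), (forall i, f (b i) = g (b i)) -> f =1 g.

(** One argument is freed at a time: first the right one against a fixed [b i], then the left one
    against an arbitrary [v]. *)
Lemma determining_tens U V I J (b : I -> U) (c : J -> V) :
  determining b -> determining c ->
  determining (fun ij : I * J => tens (b ij.1) (c ij.2)).
Proof.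
move=> detb detc W f g fg; apply: eq_linear_tens => u v.
suff fgb i : f \o tens (b i) =1 g \o tens (b i).
  exact: (detb W (f \o applyr (@tens K U V) v) (g \o applyr (@tens K U V) v)
            (fun i => fgb i v)).
by apply: detc => j; exact: (fg (i, j)).
Qed.

Lemma determining_one : determining (fun _ : unit => 1 : K^o).
Proof.
by move=> W f g fg s; rewrite -[s]mulr1 -[s * 1]/(s *: (1 : K^o)) !linearZ (fg tt).
Qed.

(* The next two lemmas unfold the packed linear maps [f \o g] and [idfun] when
   applied; simplification would also unfold the maps being composed. *)
Lemma linear_compE U V W (f : {linear V -> W}) (g : {linear U -> V}) x :
  (f \o g : {linear U -> W}) x = f (g x).
Proof. by []. Qed.

Lemma linear_idE V x : (idfun : {linear V -> V}) x = x.
Proof. by []. Qed.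

End Determining.

Section PowersetTensors.
Context (K : fieldType) (X : Type).
Local Notation V := (powV K X).
Local Notation e := (@pbase K X).

Lemma determining_pbase : determining e.
Proof. exact: eq_linear_pow. Qed.

Let det2 := determining_tens determining_pbase determining_pbase.

(** Serves the unit laws, whose second factor is the ground field. *)
Lemma eq_linear_pow1 (W : lmodType K) (f g : {linear tensor V K^o -> W}) :
  (forall a, f (tens (e a) 1) = g (tens (e a) 1)) -> f =1 g.
Proof.
move=> fg.
by apply: (determining_tens determining_pbase (@determining_one K)) => -[a []];
  exact: fg.
Qed.

Lemma eq_linear_pow2 (W : lmodType K) (f g : {linear tensor V V -> W}) :
  (forall a b, f (tens (e a) (e b)) = g (tens (e a) (e b))) -> f =1 g.
Proof. by move=> fg; apply: det2 => -[a b]; exact: fg. Qed.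

Lemma eq_linear_pow3l (W : lmodType K) (f g : {linear tensor (tensor V V) V -> W}) :
  (forall a b c, f (tens (tens (e a) (e b)) (e c)) =
                 g (tens (tens (e a) (e b)) (e c))) -> f =1 g.
Proof.
move=> fg; apply: (determining_tens det2 determining_pbase) => -[[a b] c].
exact: fg.
Qed.

Lemma eq_linear_pow3r (W : lmodType K) (f g : {linear tensor V (tensor V V) -> W}) :
  (forall a b c, f (tens (e a) (tens (e b) (e c))) =
                 g (tens (e a) (tens (e b) (e c)))) -> f =1 g.
Proof.
move=> fg; apply: (determining_tens determining_pbase det2) => -[a [b c]].
exact: fg.
Qed.

End PowersetTensors.

Theorem theorem1p5 (K : fieldType) (charK0 : [pchar K] =i pred0) (X : Type) :
  is_boolean_algebra
    (pow_cup K X) (pow_cap K X) (pow_compl K X) (pow_total K X)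
    (pow_empty K X) (pow_coprod K X) (pow_ev K X).
Proof.
(* [tassocVE] is there for [tmidswap], computed through its defining composition; [scale1r] clears
   the coefficients 1 left by [ev] and the units. *)
pose powE := (linear_compE, linear_idE, pow_cupE, pow_capE, pow_complE,
  pow_coprodE, pow_evE, pow_totalE, pow_emptyE, tmapE, tswapE, tassocE,
  tassocVE, tunitrE, scale1r).
split.
- by apply: eq_linear_pow2 => a b; rewrite !powE setUC.
- by apply: eq_linear_pow2 => a b; rewrite !powE setIC.
- by apply: eq_linear_pow3l => a b d; rewrite !powE setUA.
- by apply: eq_linear_pow3l => a b d; rewrite !powE setIA.
- by apply: eq_linear_pow3r => a b d; rewrite !powE setIUr.
- by apply: eq_linear_pow3r => a b d; rewrite !powE setUIr.
- by apply: eq_linear_pow1 => a; rewrite !powE setU0.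
- by apply: eq_linear_pow1 => a; rewrite !powE setIT.
- by apply: eq_linear_pow => a; rewrite !powE setICr.
- by apply: eq_linear_pow => a; rewrite !powE setUCr.
(* Absorption: [ev] sends [b] to 1, leaving [a] on the right. *)
- by apply: eq_linear_pow2 => a b; rewrite !powE setIC setUK.
- by apply: eq_linear_pow2 => a b; rewrite !powE setUC setIK.
(* Both sides are now copies of the same [a], so no set identity remains. *)
- by apply: eq_linear_pow => a; rewrite !powE.
- by apply: eq_linear_pow => a; rewrite !powE.
Qed.
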